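(* Let $\varphi_{\mathbb{D}}$ be a $\mathbb{D}$-valued Young function and let $\psi_{\mathbb{D}}$ be the $\mathbb{D}$-complementary function of $\varphi_{\mathbb{D}}$. Then the pair $(\varphi_{\mathbb{D}},\psi_{\mathbb{D}})$ satisfies Young's inequality: for all $x,y\in\mathbb{D}^+$, $$xy\le'\varphi_{\mathbb{D}}(x)+\psi_{\mathbb{D}}(y).$$
   Context: $\mathbb{D}=\{a+bk:a,b\in\mathbb{R}\}$, $k^2=1$, $k\notin\mathbb{R}$, is the ring of hyperbolic numbers; $e_1=\frac12(1+k)$, $e_2=\frac12(1-k)$; every $x\in\mathbb{D}$ is uniquely $\alpha e_1+\beta e_2$ with $\alpha,\beta\in\mathbb{R}$. $\mathbb{D}^+=\{\alpha e_1+\beta e_2:\alpha,\beta\ge0\}$, and $\overline{\mathbb{D}}^+$ denotes the extended set of $\alpha e_1+\beta e_2$ with $\alpha,\beta\in[0,\infty]$. The order $x\le'y$ means that each idempotent component of $x$ is $\le$ the corresponding component of $y$. Suprema in $\mathbb{D}$ are taken componentwise: $\sup S=\sup C_1\,e_1+\sup C_2\,e_2$, with $C_1,C_2$ the sets of first and second idempotent components of elements of $S$. A $\mathbb{D}$-valued Young (Orlicz) function is a function $\varphi_{\mathbb{D}}:\mathbb{D}^+\to\overline{\mathbb{D}}^+$ which is $\mathbb{D}$-convex, i.e. $\varphi_{\mathbb{D}}(\alpha x+(1-\alpha)y)\le'\alpha\varphi_{\mathbb{D}}(x)+(1-\alpha)\varphi_{\mathbb{D}}(y)$ for all $x,y\in\mathbb{D}^+$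 and $\alpha\in\mathbb{D}$ with $0\le'\alpha\le'1$ (with $0\cdot\infty=0$), satisfies $\varphi_{\mathbb{D}}(0)=0$, and $\lim_{x\to\infty}\varphi_{\mathbb{D}}(x)=+\infty$, the limit being taken along every line (ray) in $\mathbb{D}^+$ and ''$+\infty$'' meaning that at least one idempotent component is $\infty$. The $\mathbb{D}$-complementary function of $\varphi_{\mathbb{D}}$ is $\psi_{\mathbb{D}}(y)=\sup\{xy-\varphi_{\mathbb{D}}(x):x\in\mathbb{D}^+\}$, $y\in\mathbb{D}^+$. *)

(* Defs.v *)
From HB Require Import structures.
From mathcomp Require Import all_boot all_order all_algebra.
From mathcomp Require Import all_classical all_reals all_analysis.
From mathcomp Require Import ring lra.
Import Order.TTheory GRing.Theory Num.Theory.
Import numFieldNormedType.Exports.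

Set Implicit Arguments.
Unset Strict Implicit.
Unset Printing Implicit Defensive.

Local Open Scope classical_set_scope.
Local Open Scope ring_scope.

(* Hyp a b is the hyperbolic number a + b k, where k ^ 2 = 1. *)
Record hyp (R : Type) := Hyp { hyp_re : R ; hyp_im : R }.

Section HypRing.
Variable R : realType.
Implicit Types x y z : hyp R.

Definition pair_of_hyp x : R * R := (hyp_re x, hyp_im x).
Definition hyp_of_pair (p : R * R) : hyp R := Hyp p.1 p.2.
Lemma pair_of_hypK : cancel pair_of_hyp hyp_of_pair.
Proof. by case. Qed.

HB.instance Definition _ := Choice.copy (hyp R) (can_type pair_of_hypK).

Definition hyp_zero : hyp R := Hyp 0 0.
Definition hyp_one : hyp R := Hyp 1 0.
Definition hyp_opp x : hyp R := Hyp (- hyp_re x) (- hyp_im x).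
Definition hyp_add x y : hyp R :=
  Hyp (hyp_re x + hyp_re y) (hyp_im x + hyp_im y).
Definition hyp_mul x y : hyp R :=
  Hyp (hyp_re x * hyp_re y + hyp_im x * hyp_im y)
      (hyp_re x * hyp_im y + hyp_im x * hyp_re y).

Lemma hyp_addA : associative hyp_add.
Proof. by case=> a b [c d] [e f]; congr Hyp => /=; ring. Qed.
Lemma hyp_addC : commutative hyp_add.
Proof. by case=> a b [c d]; congr Hyp => /=; ring. Qed.
Lemma hyp_add0 : left_id hyp_zero hyp_add.
Proof. by case=> a b; congr Hyp => /=; ring. Qed.
Lemma hyp_addN : left_inverse hyp_zero hyp_opp hyp_add.
Proof. by case=> a b; congr Hyp => /=; ring. Qed.

HB.instance Definition _ :=
  GRing.isZmodule.Build (hyp R) hyp_addA hyp_addC hyp_add0 hyp_addN.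

Lemma hyp_mulA : associative hyp_mul.
Proof. by case=> a b [c d] [e f]; congr Hyp => /=; ring. Qed.
Lemma hyp_mulC : commutative hyp_mul.
Proof. by case=> a b [c d]; congr Hyp => /=; ring. Qed.
Lemma hyp_mul1 : left_id hyp_one hyp_mul.
Proof. by case=> a b; congr Hyp => /=; ring. Qed.
Lemma hyp_mulD : left_distributive hyp_mul hyp_add.
Proof. by case=> a b [c d] [e f]; congr Hyp => /=; ring. Qed.
Lemma hyp_one_neq0 : hyp_one != hyp_zero.
Proof. by apply/eqP => -[] /eqP; rewrite oner_eq0. Qed.

HB.instance Definition _ :=
  GRing.Zmodule_isComNzRing.Build (hyp R)
    hyp_mulA hyp_mulC hyp_mul1 hyp_mulD hyp_one_neq0.

Definition hyp_of_real (a : R) : hyp R := Hyp a 0.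
Definition hyp_k : hyp R := Hyp 0 1.
Definition hyp_e1 : hyp R := hyp_of_real 2^-1 * (1 + hyp_k).
Definition hyp_e2 : hyp R := hyp_of_real 2^-1 * (1 - hyp_k).

(* The idempotent components of x; see hyp_idemE and hyp_idem_uniq. *)
Definition idem1 x : R := hyp_re x + hyp_im x.
Definition idem2 x : R := hyp_re x - hyp_im x.

Lemma hyp_kk : hyp_k * hyp_k = 1.
Proof. by congr Hyp => /=; ring. Qed.

Lemma hyp_idem_comb (a b : R) :
  hyp_of_real a * hyp_e1 + hyp_of_real b * hyp_e2 =
  Hyp ((a + b) / 2) ((a - b) / 2).
Proof. by congr Hyp => /=; field. Qed.

Lemma hyp_idemE x :
  x = hyp_of_real (idem1 x) * hyp_e1 + hyp_of_real (idem2 x) * hyp_e2.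
Proof.
by rewrite hyp_idem_comb; case: x => a b; congr Hyp; rewrite /idem1 /idem2 /=;
  field.
Qed.

Lemma hyp_idem_uniq x (a b : R) :
  x = hyp_of_real a * hyp_e1 + hyp_of_real b * hyp_e2 ->
  a = idem1 x /\ b = idem2 x.
Proof. by rewrite hyp_idem_comb => ->; rewrite /idem1 /idem2 /=; split; field. Qed.

Definition hyp_le x y : Prop := idem1 x <= idem1 y /\ idem2 x <= idem2 y.

Definition hyp_nneg : set (hyp R) := [set x | hyp_le 0 x].

End HypRing.

Arguments hyp_nneg : clear implicits.

(* EHyp u v is the extended hyperbolic number u e1 + v e2.  Components range
   over all of [-oo, +oo], since x y - phi x has a component -oo wherever phi x
   is infinite. *)
Record ehyp (R : Type) := EHyp { eidem1 : \bar R ; eidem2 : \bar R }.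

Section ExtendedHyp.
Variable R : realType.
Implicit Types u v : ehyp R.
Local Open Scope ereal_scope.

Definition ehyp_of_hyp (x : hyp R) : ehyp R :=
  EHyp (idem1 x)%:E (idem2 x)%:E.

(* The conventions of \bar R apply in each component; in particular
   0 * +oo = 0. *)
Definition ehyp_add u v : ehyp R :=
  EHyp (eidem1 u + eidem1 v) (eidem2 u + eidem2 v).
Definition ehyp_sub u v : ehyp R :=
  EHyp (eidem1 u - eidem1 v) (eidem2 u - eidem2 v).
Definition ehyp_mul u v : ehyp R :=
  EHyp (eidem1 u * eidem1 v) (eidem2 u * eidem2 v).

Definition ehyp_le u v : Prop :=
  eidem1 u <= eidem1 v /\ eidem2 u <= eidem2 v.

Definition ehyp_nneg : set (ehyp R) := [set u | ehyp_le (ehyp_of_hyp 0%R) u].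

Definition ehyp_sup (S : set (ehyp R)) : ehyp R :=
  EHyp (ereal_sup (@eidem1 R @` S)) (ereal_sup (@eidem2 R @` S)).

Definition ehyp_infinite u : Prop := eidem1 u = +oo \/ eidem2 u = +oo.

End ExtendedHyp.

Arguments ehyp_nneg : clear implicits.

Declare Scope hyp_scope.
Delimit Scope hyp_scope with hyp.
Notation "x <=' y" := (hyp_le x y) (at level 70) : hyp_scope.

Declare Scope ehyp_scope.
Delimit Scope ehyp_scope with ehyp.
Bind Scope ehyp_scope with ehyp.
Notation "x %:EH" := (ehyp_of_hyp x%R) (at level 2, format "x %:EH").
Notation "u + v" := (ehyp_add u v) : ehyp_scope.
Notation "u - v" := (ehyp_sub u v) : ehyp_scope.
Notation "u * v" := (ehyp_mul u v) : ehyp_scope.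
Notation "u <=' v" := (ehyp_le u v) (at level 70) : ehyp_scope.

Section Young.
Variable R : realType.
Implicit Types phi : hyp R -> ehyp R.

Definition hyp_convex phi : Prop :=
  forall x y alpha : hyp R, hyp_nneg R x -> hyp_nneg R y ->
    (0 <=' alpha)%hyp -> (alpha <=' 1)%hyp ->
    (phi (alpha * x + (1 - alpha) * y)%R <='
       alpha%:EH * phi x + (1 - alpha)%:EH * phi y)%ehyp.

(* Along every ray t |-> u + t v (t >= 0, v <> 0) contained in hyp_nneg, phi
   has a componentwise limit with at least one infinite component. *)
Definition tends_to_infinity_along_rays phi : Prop :=
  forall u v : hyp R, v != 0 ->
    (forall t : R, 0 <= t -> hyp_nneg R (u + hyp_of_real t * v)) ->
    exists l : ehyp R,
      [/\ eidem1 (phi (u + hyp_of_real t * v)) @[t --> +oo%R] --> eidem1 l,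
          eidem2 (phi (u + hyp_of_real t * v)) @[t --> +oo%R] --> eidem2 l &
          ehyp_infinite l].

(* A function on hyp_nneg is represented by a total function, whose values
   elsewhere are never used. *)
Record young_function phi : Prop := YoungFunction {
  young_nneg : forall x, hyp_nneg R x -> ehyp_nneg R (phi x) ;
  young_convex : hyp_convex phi ;
  young_0 : phi 0 = 0%:EH ;
  young_infty : tends_to_infinity_along_rays phi }.

Definition complementary phi (y : hyp R) : ehyp R :=
  ehyp_sup [set ((x * y)%R%:EH - phi x)%ehyp | x in hyp_nneg R].

End Young.

(* Main.v *)
(** Taking [x] itself in the supremum defining the complementary function gives
    [x y - phi x <=' psi y].  Where [phi x] has a finite component it can be
    moved to the right.  Where the component is [+oo], the sum must not be the
    indeterminate [+oo - oo]: taking [0] in the supremum gives [0 <=' psi y]. *)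
Require Import Defs.
From mathcomp Require Import all_boot all_order all_algebra.
From mathcomp Require Import all_classical all_reals all_analysis.
Import Order.TTheory GRing.Theory Num.Theory.
Local Open Scope ring_scope.

Lemma idem1_0 (R : realType) : idem1 (0 : hyp R) = 0.
Proof. exact: addr0. Qed.

Lemma idem2_0 (R : realType) : idem2 (0 : hyp R) = 0.
Proof. exact: subr0. Qed.

Lemma le_add_of_sub_le (R : realType) (a : R) (p q : \bar R) :
  (0 <= p -> 0 <= q -> a%:E - p <= q -> a%:E <= p + q)%E.
Proof.
case: p => [r| |] // _ q0; first by rewrite leeBlDl.
(* Here [p] is [+oo]. Since [+oo + -oo] is [-oo] in [\bar R], the bound [0 <= q] is what makes the
   sum [+oo]. *)
by move=> _; rewrite addye ?leey // -ltNye (lt_le_trans _ q0) ?ltNyr.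
Qed.

Lemma complementary_ub (R : realType) (phi : hyp R -> ehyp R) (x y : hyp R) :
  hyp_nneg R x -> ((x * y)%R%:EH - phi x <=' complementary phi y)%ehyp.
Proof.
(* Each component is a supremum over an image of an image, hence two nested witnesses. *)
by move=> hx; split; apply: ereal_sup_ubound;
  exists ((x * y)%R%:EH - phi x)%ehyp => //; exists x.
Qed.

(** The term of the supremum at [0] is [0 * y - phi 0 = 0]. *)
Lemma complementary_nneg (R : realType) (phi : hyp R -> ehyp R) (y : hyp R) :
  phi 0 = 0%:EH -> ehyp_nneg R (complementary phi y).
Proof.
move=> phi0; have h0 : hyp_nneg R 0 by split; exact: lexx.
have := complementary_ub _ phi _ y h0.
by rewrite phi0 mul0r /ehyp_sub /ehyp_nneg /ehyp_of_hyp /= idem1_0 idem2_0 sube0.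
Qed.

Theorem theorem2p23 (R : realType) (phi : hyp R -> ehyp R)
    (hphi : young_function phi) (psi : hyp R -> ehyp R)
    (hpsi : forall y : hyp R, hyp_nneg R y -> psi y = complementary phi y)
    (x y : hyp R) (hx : hyp_nneg R x) (hy : hyp_nneg R y) :
  ((x * y)%R%:EH <=' phi x + psi y)%ehyp.
Proof.
rewrite hpsi //.
have [p1 p2] := young_nneg hphi hx.
have [q1 q2] := complementary_nneg _ _ y (young_0 hphi).
have [s1 s2] := complementary_ub _ phi _ y hx.
rewrite /= idem1_0 in p1 q1; rewrite /= idem2_0 in p2 q2.
by split; apply: le_add_of_sub_le.
Qed.
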